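(* Let $q\in\mathbb Z$. For every commutative ring $R$ with identity, let $$\varphi_R^q:\mathbf{Ap}^q(R)\to\mathbf{Gh}(R),\qquad \mathbf x=(x_n)_{n\ge1}\mapsto\Big(\sum_{d\mid n}q^{\frac nd-1}x_d\Big)_{n\ge1}.$$ Then: (a) $\varphi_R^q$ is an isomorphism of the additive group $\mathbf{Ap}^q(R)$ onto $\mathbf{Gh}(R)$. (b) For any $\mathbf x,\mathbf y\in\mathbf{Ap}^q(R)$, $\varphi_R^q(\mathbf x\mathbf y)=\varphi_R^q(\mathbf x)\varphi_R^q(\mathbf y)$.
   Context: $0^0=1$. $\mathbf{Gh}(R)=R^{\mathbb N}$ with componentwise addition and multiplication. $[i,j]$ and $(i,j)$ denote lcm and gcd. $\mu$ is the classical Möbius function and $S(x,d)=\sum_{e\mid d}\mu(e)x^{d/e}$. For positive integers let $\zeta^q(d_1,d_2)=\frac{d_1}{d_2}q^{\frac{d_2}{d_1}-1}$ if $d_1\mid d_2$ and $0$ otherwise, and let $\mu^q(d,n)$ be the $(d,n)$ entry of the inverse of the matrix $\zeta^q$ indexed by the divisors of $n$. Put $\tau^q(i,n)=\sum_{d\mid i}\mu^q(1,d)\zeta^q(d,n)$ for $i\mid n$. For $[i,j]\mid n$ let $$P_{n,i,j}(q)=\frac{j}{(i,j)\,q}\sum_{d\mid n/[i,j]}\tau^q\Big(\frac{n}{[i,j]d},\frac ni\Big)S\big(q^{[i,j]/j},d\big).$$ As an expression in an indeterminate $q$ this is a numerical polynomial in $\mathbb Q[q]$ (it takes integer values at integers),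 and $P_{n,i,j}(q)$ for $q\in\mathbb Z$ denotes its value. $\mathbf{Ap}^q(R)$ is the set $R^{\mathbb N}$ with componentwise addition and multiplication whose $n$-th component is $$(\mathbf x\cdot\mathbf y)_n=\sum_{[i,j]\mid n}\frac{n}{[i,j]}P_{n,i,j}(q)\,x_iy_j .$$ *)

(* Defs.v *)
From HB Require Import structures.
From mathcomp Require Import all_boot all_order all_algebra.
From mathcomp Require Import boolp classical_sets functions.
Set Implicit Arguments.
Unset Strict Implicit.
Unset Printing Implicit Defensive.
Import GRing.Theory Num.Theory.
Local Open Scope ring_scope.

Definition posnat : Type := {n : nat | (0 < n)%N}.

Definition moebius (n : nat) : int :=
  if all (fun p => ~~ (p ^ 2 %| n)%N) (primes n) then (-1) ^+ size (primes n)
  else 0.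

Definition S_sum (A : pzRingType) (x : A) (d : nat) : A :=
  \sum_(e <- divisors d) (moebius e)%:~R * x ^+ (d %/ e).

(* In the polynomial definitions below the indeterminate q is 'X. *)

Definition zeta (d1 d2 : nat) : {poly rat} :=
  if (d1 %| d2)%N then (d1%:R / d2%:R) *: 'X^(d2 %/ d1 - 1) else 0.

(* The divisors of n > 0 are indexed in increasing order by
   'I_(size (divisors n)); this is written as a successor so that [inord]
   applies. *)
Definition zeta_mx (n : nat) : 'M[{poly rat}]_((size (divisors n)).-1.+1) :=
  \matrix_(i, j) zeta (nth 0%N (divisors n) i) (nth 0%N (divisors n) j).

Definition mu (d n : nat) : {poly rat} :=
  invmx (zeta_mx n) (inord (index d (divisors n)))
                    (inord (index n (divisors n))).

Lemma det_zeta_mx (n : nat) : (0 < n)%N -> \det (zeta_mx n) = 1.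
Proof.
move=> n0; have sz : (0 < size (divisors n))%N.
  by rewrite -has_predT; apply/hasP; exists n => //; apply: divisors_id.
have nthE (i : 'I_(size (divisors n)).-1.+1) :
    nth 0%N (divisors n) i \in divisors n.
  by apply: mem_nth; rewrite -[leqRHS](prednK sz).
have nth_gt0 i : (0 < nth 0%N (divisors n) (i : 'I_(size (divisors n)).-1.+1))%N.
  by have := nthE i; rewrite -dvdn_divisors // => /dvdn_gt0; apply.
rewrite -det_tr det_trig; last first.
  apply/is_trig_mxP => i j ij; rewrite !mxE /zeta; case: ifP => // /dvdn_leq.
  move=> /(_ (nth_gt0 i)); rewrite leqNgt.
  suff -> : (nth 0 (divisors n) i < nth 0 (divisors n) j)%N by [].
  have := sorted_divisors_ltn n; move/(sorted_ltn_nth ltn_trans 0%N).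
  by apply => //; rewrite inE -[leqRHS](prednK sz).
apply: big1 => i _; rewrite !mxE /zeta dvdnn divnn nth_gt0 subnn expr0.
by rewrite divff ?scale1r // pnatr_eq0 -lt0n.
Qed.

Lemma zeta_mx_unit (n : nat) : (0 < n)%N -> zeta_mx n \in unitmx.
Proof. by move=> n0; rewrite unitmxE det_zeta_mx // unitr1. Qed.

Definition tau (i n : nat) : {poly rat} :=
  \sum_(d <- divisors i) mu 1 d * zeta d n.

(* q P_{n,i,j}(q) *)
Definition qP (n i j : nat) : {poly rat} :=
  (j%:R / (gcdn i j)%:R) *:
    \sum_(d <- divisors (n %/ lcmn i j))
      tau (n %/ (lcmn i j * d)) (n %/ i)
      * S_sum ('X^(lcmn i j %/ j)) d.

Lemma dvdX_qP (n i j : nat) : (0 < i)%N -> (0 < j)%N -> 'X %| qP n i j.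
Proof.
move=> i0 j0; rewrite /qP -mul_polyC; apply: dvdp_mull.
have dvd0 := dvdp0 ('X : {poly rat}); have dvdD := @dvdp_add rat 'X.
rewrite big_seq; elim/big_ind: _ => // d dN; apply: dvdp_mull.
have d0 : (0 < d)%N.
  move: dN; case: (posnP (n %/ lcmn i j)) => [->|N0].
    by rewrite inE => /eqP->.
  by rewrite -dvdn_divisors // => /(dvdn_gt0 N0).
rewrite /S_sum big_seq; elim/big_ind: _ => // e; rewrite -dvdn_divisors // => ed.
have a0 : (0 < lcmn i j %/ j * (d %/ e))%N.
  rewrite muln_gt0 !divn_gt0 ?(dvdn_gt0 d0 ed) ?(dvdn_leq d0 ed) //.
  by rewrite dvdn_leq ?lcmn_gt0 ?i0 // dvdn_lcmr.
by apply: dvdp_mull; rewrite -exprM -(prednK a0) exprS dvdp_mulIl.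
Qed.

(* The division is exact by [dvdX_qP]. *)
Definition P (n i j : nat) : {poly rat} := qP n i j %/ 'X.

(* P n i j takes integer values at integers, so its value is its numerator. *)
Definition P_at (n i j : nat) (q : int) : int := numq (P n i j).[q%:~R].

Definition Gh (R : comPzRingType) : Type := posnat -> R.
HB.instance Definition _ (R : comPzRingType) :=
  GRing.ComPzRing.copy (Gh R) (posnat -> R).

Definition Ap (q : int) (R : comPzRingType) : Type := posnat -> R.
HB.instance Definition _ (q : int) (R : comPzRingType) :=
  GRing.Zmodule.copy (Ap q R) (posnat -> R).

(* The component of x at a natural number; the default 0 is only used at
   index 0. *)
Definition coord (R : comPzRingType) (x : posnat -> R) (n : nat) : R :=
  if insub n is Some k then x k else 0.

Definition Ap_mul (q : int) (R : comPzRingType) (x y : Ap q R) : Ap q R :=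
  fun n : posnat =>
    \sum_(1 <= i < (val n).+1)
      \sum_(1 <= j < (val n).+1 | (lcmn i j %| val n)%N)
        (val n %/ lcmn i j)%:R * (P_at (val n) i j q)%:~R
        * coord x i * coord y j.

Definition phi (q : int) (R : comPzRingType) (x : Ap q R) : Gh R :=
  fun n : posnat =>
    \sum_(d <- divisors (val n)) q%:~R ^+ (val n %/ d - 1) * coord x d.

(* Main.v *)
Require Import Defs.
From mathcomp Require Import all_boot all_order all_algebra.
From mathcomp Require Import boolp classical_sets functions.
From mathcomp Require Import cyclic zify.
Import GRing.Theory Num.Theory.
Local Open Scope ring_scope.
Set Implicit Arguments.
Unset Strict Implicit.
Unset Printing Implicit Defensive.

(* The ghost map is unitriangular for divisibility, hence bijective.  For its
   multiplicativity put l = [i,j], s = l/i + l/j, and let g be the Dirichlet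
   inverse of m |-> q^(m-1), so that mu^q(1,m) = g(m)/m.  Since
   sum_(d | m) S(x,d) = x^m, the definition of P collapses to
     m P_{lm,i,j}(q) = sum_(c | m) g(c) q^(s m/c - 2),
   and convolving with q^(m-1) gives
     sum_(m | n) q^(n/m-1) m P_{lm,i,j}(q) = q^(s n - 2),
   which is the comparison of the coefficients of x_i y_j.  The sequence
   a(m) = m P_{lm,i,j}(q) is integral by this recursion, and P_{lm,i,j}(q) is an
   integer because m | a(m), which is proved one prime at a time. *)

(** * Reindexing of sums and double sums over divisors *)

Section DivisorSums.
Variable V : nmodType.
Implicit Types (n : nat) (F : nat -> V).

Lemma sum_divisors_multiples n d F : (0 < n)%N -> (d %| n)%N ->
  \sum_(e <- divisors n | (d %| e)%N) F e =
  \sum_(c <- divisors (n %/ d)) F (d * c)%N.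
Proof.
move=> n0 dn; have d0 := dvdn_gt0 n0 dn.
have nd0 : (0 < n %/ d)%N by rewrite divn_gt0 // dvdn_leq.
rewrite -big_filter -(big_map (muln d) xpredT); apply: perm_big.
apply: uniq_perm; first by rewrite filter_uniq ?divisors_uniq.
  rewrite map_inj_uniq ?divisors_uniq // => a b /eqP.
  by rewrite eqn_pmul2l // => /eqP.
move=> e; rewrite mem_filter -dvdn_divisors //; apply/andP/mapP.
  move=> [/dvdnP[c ->] cn]; exists c; last by rewrite mulnC.
  by rewrite -dvdn_divisors // -(@dvdn_pmul2r d) // divnK.
move=> [c]; rewrite -dvdn_divisors // => cn ->; split; first exact: dvdn_mulr.
by rewrite -(divnK dn) mulnC dvdn_pmul2r.
Qed.

Lemma sum_divisors_sub n m F (Q : pred nat) : (0 < n)%N -> (m %| n)%N ->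
  \sum_(d <- divisors n | Q d && (d %| m)%N) F d =
  \sum_(d <- divisors m | Q d) F d.
Proof.
move=> n0 mn; have m0 := dvdn_gt0 n0 mn.
rewrite -big_filter -[RHS]big_filter; apply: perm_big.
apply: uniq_perm; rewrite ?filter_uniq ?divisors_uniq // => d.
rewrite !mem_filter -!dvdn_divisors // -andbA; case: (Q d) => //=.
by case: (boolP (d %| m)%N) => //= dm; rewrite (dvdn_trans dm mn).
Qed.

Lemma sum_divisors_flip n F :
  (0 < n)%N -> \sum_(d <- divisors n) F (n %/ d)%N = \sum_(d <- divisors n) F d.
Proof.
move=> n0; rewrite -(big_map (divn n) xpredT); apply: perm_big.
have inv d : d \in divisors n -> (n %/ (n %/ d))%N = d.
  by rewrite -dvdn_divisors // => dn; rewrite divnA // mulKn.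
have dv d : d \in divisors n -> (n %/ d)%N \in divisors n.
  by rewrite -!dvdn_divisors // => dn; apply: dvdn_div.
apply: uniq_perm; rewrite ?divisors_uniq //.
  rewrite map_inj_in_uniq ?divisors_uniq // => a b an bn eab.
  by rewrite -(inv a an) eab inv.
move=> e; apply/mapP/idP => [[d dn ->]|en]; first exact: dv.
by exists (n %/ e)%N; rewrite ?dv ?inv.
Qed.

Lemma sum_divisors_exchange n (F : nat -> nat -> V) : (0 < n)%N ->
  \sum_(d <- divisors n) \sum_(c <- divisors (n %/ d)) F d (d * c)%N =
  \sum_(e <- divisors n) \sum_(d <- divisors e) F d e.
Proof.
move=> n0; under eq_big_seq => d.
  by rewrite -dvdn_divisors // => dn; rewrite -sum_divisors_multiples //; over.
rewrite (exchange_big_dep xpredT) //=; apply: eq_big_seq => e.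
by rewrite -dvdn_divisors // => en; rewrite (@sum_divisors_sub n e _ xpredT).
Qed.

(** Both sides run over the pairs with [d * c] dividing [n]. Grouping them by the product [e] turns
    the interchange into the involution [d] to [e %/ d] on the divisors of [e]. *)
Lemma sum_divisors_swap n (F : nat -> nat -> V) : (0 < n)%N ->
  \sum_(d <- divisors n) \sum_(c <- divisors (n %/ d)) F d c =
  \sum_(c <- divisors n) \sum_(d <- divisors (n %/ c)) F d c.
Proof.
move=> n0; have pos d : d \in divisors n -> (0 < d)%N.
  by rewrite -dvdn_divisors // => /(dvdn_gt0 n0).
have collect (G : nat -> nat -> V) :
    \sum_(d <- divisors n) \sum_(c <- divisors (n %/ d)) G d c =
    \sum_(e <- divisors n) \sum_(d <- divisors e) G d (e %/ d)%N.
  rewrite -(sum_divisors_exchange (fun d e => G d (e %/ d)%N)) //.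
  by apply: eq_big_seq => d /pos d0; apply: eq_bigr => c _; rewrite mulKn.
rewrite collect (collect (fun c d => F d c)); apply: eq_big_seq => e /pos e0.
rewrite -(sum_divisors_flip _ e0); apply: eq_big_seq => d.
rewrite -dvdn_divisors // => de; congr (F _ _).
by rewrite divnA // mulKn.
Qed.

End DivisorSums.

(** * Systems that are unitriangular for divisibility *)

Section Triangular.
Variables (A : pzRingType) (f : nat -> A).
Hypothesis f1 : f 1%N = 1.

Lemma sum_divisors_top (u : nat -> A) n : (0 < n)%N ->
  \sum_(d <- divisors n) f (n %/ d)%N * u d =
  u n + \sum_(d <- divisors n | (d < n)%N) f (n %/ d)%N * u d.
Proof.
move=> n0; rewrite (bigD1_seq n) ?divisors_uniq -?dvdn_divisors //=.
rewrite divnn n0 f1 mul1r; congr (_ + _); rewrite big_seq_cond [RHS]big_seq_cond.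
apply: eq_bigl => d; rewrite -dvdn_divisors //.
case: (boolP (d %| n)%N) => //= /(dvdn_leq n0).
by rewrite leq_eqVlt; case: ltngtP.
Qed.

Lemma sum_divisors_inj (u v : nat -> A) :
  (forall n, (0 < n)%N -> \sum_(d <- divisors n) f (n %/ d)%N * u d =
                         \sum_(d <- divisors n) f (n %/ d)%N * v d) ->
  forall n, (0 < n)%N -> u n = v n.
Proof.
move=> uv n; elim/ltn_ind: n => n IH n0; have := uv n n0.
rewrite !sum_divisors_top // => /(canRL (addrK _)) ->.
apply/(canLR (addrK _)); congr (_ + _).
rewrite big_seq_cond [RHS]big_seq_cond; apply: eq_bigr => d.
rewrite -dvdn_divisors // => /andP[dn ltdn].
by rewrite IH // (dvdn_gt0 n0 dn).
Qed.

(** Since [f 1 = 1], the equation at [n] determines [u n] from the values of [u] at the proper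
    divisors of [n], without any division in [A]. *)
Lemma sum_divisors_solve (h : nat -> A) :
  exists u, forall n, (0 < n)%N -> \sum_(d <- divisors n) f (n %/ d)%N * u d = h n.
Proof.
pose rest (u : nat -> A) n :=
  \sum_(d <- divisors n | (d < n)%N) f (n %/ d)%N * u d.
(* The argument [k] is fuel that makes the recursion structural. By [solE] any fuel at least [n]
   gives the same value at [n], so the diagonal [sol n n] is a solution. *)
pose sol := fix sol k n := if k is k'.+1 then h n - rest (sol k') n else 0.
have solE k : forall l n, (0 < n)%N -> (n <= k)%N -> (n <= l)%N -> sol k n = sol l n.
  elim: k => [|k IH] [|l] n; [by lia..|] => n0 nk nl /=.
  congr (_ - _); rewrite /rest big_seq_cond [RHS]big_seq_cond.
  apply: eq_bigr => d; rewrite -dvdn_divisors // => /andP[dn ltdn].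
  congr (_ * _); have := dvdn_gt0 n0 dn => d0; apply: IH; lia.
exists (fun n => sol n n) => n n0; rewrite sum_divisors_top //.
case: n n0 => // n n0 /=; rewrite -[RHS](subrK (rest (sol n) n.+1)); congr (_ + _).
rewrite /rest big_seq_cond [RHS]big_seq_cond.
apply: eq_bigr => d; rewrite -dvdn_divisors // => /andP[dn ltdn].
congr (_ * _); have := dvdn_gt0 n0 dn => d0; apply: solE; lia.
Qed.

End Triangular.

(** * The Möbius function and the sums S(x,d) *)

Lemma moebius_mul_prime p d : prime p -> (0 < d)%N ->
  moebius (p * d) = if (p %| d)%N then 0 else - moebius d.
Proof.
move=> pp d0; have pd0 : (0 < p * d)%N by rewrite muln_gt0 prime_gt0.
rewrite /moebius; case: (boolP (p %| d)%N) => [pd|npd].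
  case: allP => // /(_ p); rewrite mem_primes pp pd0 dvdn_mulr // => /(_ isT).
  by rewrite expnS expn1 dvdn_pmul2l ?(prime_gt0 pp) // pd.
have cop : coprime p d by rewrite prime_coprime.
have pn : p \notin primes d by rewrite mem_primes (negbTE npd) !andbF.
have perm : perm_eq (primes (p * d)) (p :: primes d).
  apply: uniq_perm; rewrite ?primes_uniq //= ?pn ?primes_uniq // => r.
  by rewrite primesM ?(prime_gt0 pp) // primes_prime // inE in_cons.
rewrite (perm_all _ perm) (perm_size perm) /= exprS mulN1r.
have -> : ~~ (p ^ 2 %| p * d)%N.
  by rewrite expnS expn1 dvdn_pmul2l ?(prime_gt0 pp).
(* A prime [r] of [d] differs from [p], so [r ^ 2] is coprime to [p] and divides [p * d] exactly
   when it divides [d]. *)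
rewrite (eq_in_all (a2 := fun r => ~~ (r ^ 2 %| d)%N)) /=; last first.
  move=> r; rewrite mem_primes => /and3P[pr _ rd]; rewrite Gauss_dvdr //.
  rewrite coprime_pexpl // prime_coprime // dvdn_prime2 //.
  by apply: contra npd => /eqP<-.
by case: ifP => //; rewrite oppr0.
Qed.

(** For a prime [p] dividing [n], the divisors [p * c] with [p] not dividing [c] cancel those prime
    to [p]; multiples of [p ^ 2] contribute nothing. The cancellation is exact because [n] and
    [n %/ p] have the same divisors prime to [p]. *)
Lemma sum_moebius n : (0 < n)%N ->
  \sum_(d <- divisors n) moebius d = (n == 1%N)%:R.
Proof.
case: (leqP n 1) => [|n1 n0]; first by case: n => [|[|]] //; rewrite big_seq1.
have pp := pdiv_prime n1; set p := pdiv n in pp.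
have pn : (p %| n)%N by apply: pdiv_dvd.
have np0 : (0 < n %/ p)%N by rewrite divn_gt0 ?(prime_gt0 pp) // dvdn_leq.
rewrite (gtn_eqF n1).
rewrite (bigID (fun d => p %| d)%N) /= sum_divisors_multiples //.
rewrite (eq_big_seq (fun c => - if ~~ (p %| c)%N then moebius c else 0)).
  rewrite sumrN -big_mkcond /= addrC; apply/eqP; rewrite subr_eq0; apply/eqP.
  rewrite -(sum_divisors_sub _ _ n0 (dvdn_div pn)).
  rewrite big_seq_cond [RHS]big_seq_cond; apply: eq_bigl => d.
  rewrite -dvdn_divisors //; case: (boolP (d %| n)%N) => //= dn.
  case: (boolP (p %| d)%N) => //= npd; apply/esym.
  rewrite -(@Gauss_dvdr _ p) 1?mulnC ?divnK //.
  by rewrite coprime_sym prime_coprime.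
move=> c; rewrite -dvdn_divisors // => /(dvdn_gt0 np0) c0.
by rewrite moebius_mul_prime //; case: ifP; rewrite ?oppr0.
Qed.

(** Regrouping by the exponent [n %/ m] gives each power of [x] the coefficient obtained by summing
    [moebius] over the divisors of [m], so only [m = 1] survives. *)
Lemma sum_S_sum (A : comPzRingType) (x : A) n : (0 < n)%N ->
  \sum_(d <- divisors n) S_sum x d = x ^+ n.
Proof.
move=> n0; rewrite /S_sum.
rewrite -(sum_divisors_exchange (fun e d => (moebius e)%:~R * x ^+ (d %/ e))) //.
under eq_big_seq => d.
  rewrite -dvdn_divisors // => dn; have d0 := dvdn_gt0 n0 dn.
  have nd0 : (0 < n %/ d)%N by rewrite divn_gt0 // dvdn_leq.
  under eq_bigr do rewrite mulKn //.
  rewrite -(sum_divisors_flip _ nd0).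
  under eq_bigr do rewrite -divnMA.
  over.
rewrite (sum_divisors_exchange (fun d m => (moebius d)%:~R * x ^+ (n %/ m))) //.
under eq_big_seq => e.
  rewrite -dvdn_divisors // => /(dvdn_gt0 n0) e0.
  rewrite -mulr_suml -rmorph_sum /= sum_moebius //; over.
rewrite (bigD1_seq 1%N) ?divisors_uniq -?dvdn_divisors ?dvd1n //= divn1.
rewrite mul1r big1 ?addr0 // => e /negbTE ->; exact: mul0r.
Qed.

(** * Integrality: the recursion forces n to divide a(n) *)

Lemma Euler_dvdz (q : int) m x y : coprime `|q| m -> (y <= x)%N ->
  (totient m %| x - y)%N -> (m%:Z %| q ^+ x - q ^+ y)%Z.
Proof.
move=> cqm lyx /dvdnP[c xy].
rewrite -(subnK lyx) exprD -[X in _ - X]mul1r -mulrBl; apply: dvdz_mulr.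
case: (posnP m) => [m0|m0]; first by rewrite xy m0 muln0 expr0 subrr dvdz0.
have m0z : m%:Z != 0 by rewrite -lt0n.
(* The integer [q], possibly negative, is replaced by its residue in [nat], where Euler's theorem
   applies. *)
have [r qr] : exists r : nat, (q %% m)%Z = r%:Z.
  by exists `|(q %% m)%Z|%N; rewrite gez0_abs // modz_ge0.
have crm : coprime r m.
  have : coprimez q m by [].
  by rewrite /coprimez -gcdz_modl qr.
rewrite -eqz_mod_dvd; apply/eqP; rewrite -modzXm qr -(rmorphXn Posz) /=.
rewrite natrXE (modz_nat 1) modz_nat xy mulnC expnM; congr Posz.
by rewrite -modnXm Euler_exp_totient // modnXm exp1n.
Qed.

Lemma dvdz_necklace (q : int) s (a : nat -> int) : (1 < s)%N ->
  (forall n, (0 < n)%N ->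
     \sum_(d <- divisors n) q ^+ (n %/ d - 1) * a d = q ^+ (s * n - 2)) ->
  forall n, (0 < n)%N -> (n%:Z %| a n)%Z.
Proof.
move=> s1 aE n; elim/ltn_ind: n => n IH n0.
rewrite dvdzE absz_nat; apply/dvdn_partP => // p.
rewrite mem_primes => /and3P[pp _ pn]; rewrite p_part; set k := logn p n.
have p0 := prime_gt0 pp; have p1 := prime_gt1 pp.
have k0 : (0 < k)%N by rewrite logn_gt0 mem_primes pp n0.
change (((p ^ k)%N%:Z %| a n)%Z).
(* Here [t] is the exponent of [p] in [n %/ d]. Induction already puts [p ^ (k - t)] into [a d], so
   the coefficient of [a d] only has to supply [p ^ t]. *)
have IHd d : (d %| n)%N -> (d < n)%N ->
    exists2 t, (p ^ t %| n %/ d)%N &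
      ((p ^ (k - t))%N%:Z %| a d)%Z /\ (t <= k)%N.
  move=> dn ltdn; have d0 := dvdn_gt0 n0 dn.
  have nd0 : (0 < n %/ d)%N by rewrite divn_gt0 // dvdn_leq.
  exists (logn p (n %/ d)); rewrite ?pfactor_dvdnn //.
  have -> : k = (logn p d + logn p (n %/ d))%N.
    by rewrite -lognM // mulnC divnK.
  rewrite addnK leq_addl; split=> //; apply: dvdz_trans (IH d ltdn d0).
  by rewrite dvdzE !absz_nat pfactor_dvdnn.
(* If p | q, every other term of the recursion at n is already divisible by
   p^k, because t < p^t.  Otherwise subtract the recursion at n/p from the one
   at n and use Euler's theorem. *)
case: (boolP (p %| `|q|)%N) => [pq|npq].
  have pexp c e : (c <= e)%N -> ((p ^ c)%N%:Z %| q ^+ e)%Z.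
    move=> ce; rewrite dvdzE abszX absz_nat.
    exact: dvdn_trans (dvdn_exp2l p ce) (dvdn_exp2r e pq).
  have pk_lt : (k < p ^ k)%N by apply: ltn_expl.
  have := aE n n0; rewrite (sum_divisors_top (f := fun m => q ^+ (m - 1))) //.
  move=> /(canRL (addrK _)) ->; apply: rpredB.
    apply: pexp; have : (p ^ k <= n)%N by rewrite dvdn_leq ?pfactor_dvdnn.
    nia.
  rewrite big_seq_cond; apply: rpred_sum => d; rewrite -dvdn_divisors //.
  move=> /andP[dn ltdn]; have [t pt [pa tk]] := IHd d dn ltdn.
  have d0 := dvdn_gt0 n0 dn.
  have nd0 : (0 < n %/ d)%N by rewrite divn_gt0 // dvdn_leq.
  rewrite -(subnKC tk) expnD PoszM; apply: dvdz_mul => //; apply: pexp.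
  have := dvdn_leq nd0 pt; have := ltn_expl t p1; lia.
have cop t : coprime `|q| (p ^ t).
  by rewrite coprime_sym coprimeXl // prime_coprime.
(* For positive [t], the totient of [p ^ t] is [p.-1 * p ^ t.-1], and [p ^ t.-1] divides [m]. *)
have eul t x y m : (y <= x)%N -> (p ^ t %| p * m)%N -> (m * p.-1 %| x - y)%N ->
    ((p ^ t)%N%:Z %| q ^+ x - q ^+ y)%Z.
  case: t => [|t] lyx ptm mxy; first by rewrite expn0 dvd1z.
  apply: Euler_dvdz => //; rewrite totient_pfactor //=.
  apply: dvdn_trans mxy; rewrite mulnC dvdn_mul //.
  by move: ptm; rewrite expnS dvdn_pmul2l.
have np0 : (0 < n %/ p)%N by rewrite divn_gt0 // dvdn_leq.
have pnp : (p * (n %/ p) = n)%N by rewrite mulnC divnK.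
have := congr2 (fun x y => x - y) (aE n n0) (aE _ np0).
rewrite /= (sum_divisors_top (f := fun m => q ^+ (m - 1))) //.
(* Extending the recursion at [n %/ p] by zeros to all proper divisors of [n] lets the two
   recursions be subtracted term by term. *)
have -> : \sum_(d <- divisors (n %/ p)) q ^+ (n %/ p %/ d - 1) * a d =
  \sum_(d <- divisors n | (d < n)%N)
    if (d %| n %/ p)%N then q ^+ (n %/ p %/ d - 1) * a d else 0.
  rewrite -big_mkcondr /= sum_divisors_sub ?dvdn_div // [RHS]big_mkcond.
  apply: eq_big_seq => d; rewrite -dvdn_divisors // => /(dvdn_leq np0) dle.
  by rewrite (leq_ltn_trans dle) // ltn_Pdiv.
rewrite -addrA -sumrB => /(canRL (addrK _)) ->; apply: rpredB.
  (* This bound keeps the subtractions of 2 from truncating, so the two exponents differ by exactly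
     [s * (n %/ p * p.-1)]. *)
  have le2 : (2 <= s * (n %/ p))%N by apply: leq_trans s1 _; rewrite leq_pmulr.
  have sn : (s * n = s * (n %/ p) + s * (n %/ p * p.-1))%N.
    by rewrite -mulnDr -mulnS prednK // divnK.
  apply: (eul _ _ _ (n %/ p)%N); rewrite ?pnp ?pfactor_dvdnn //.
    by rewrite leq_sub2r // leq_mul2l leq_div orbT.
  by rewrite sn addnC -addnBA // addnK dvdn_mull.
rewrite big_seq_cond; apply: rpred_sum => d; rewrite -dvdn_divisors //.
move=> /andP[dn ltdn]; have d0 := dvdn_gt0 n0 dn.
have [t pt [pa tk]] := IHd d dn ltdn.
have [e ne] : exists e, n = (d * e)%N by exists (n %/ d)%N; rewrite mulnC divnK.
move: pt; rewrite ne mulKn // => pt.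
(* If [p] does not divide [e], then [t = 0] and [a d] alone carries [p ^ k]. If [e = m * p], the
   paired terms give [a d] times a difference of powers of [q] with exponents [e - 1] and [m - 1],
   to which [eul] applies. *)
case: (boolP (p %| e)%N) => [/dvdnP[m em]|npe]; last first.
  have t0 : t = 0%N.
    case: t pt {pa tk} => // t; rewrite expnS.
    by move=> /(dvdn_trans (dvdn_mulr _ (dvdnn p))); rewrite (negbTE npe).
  rewrite t0 subn0 in pa.
  by apply: rpredB; [|case: ifP => _; rewrite ?dvdz0 //]; apply: dvdz_mull.
have ndp : (n %/ p = d * m)%N by rewrite ne em mulnA mulnK.
have m0 : (0 < m)%N by move: np0; rewrite ndp muln_gt0 => /andP[].
rewrite -ne ndp dvdn_mulr // mulKn // -mulrBl -(subnKC tk) expnD PoszM.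
apply: dvdz_mul => //; apply: (eul _ _ _ m); rewrite ?[(p * m)%N]mulnC -?em //.
  by rewrite leq_sub2r // em leq_pmulr.
by rewrite -subnDA subnKC // em -[X in (_ - X)%N]muln1 -mulnBr subn1.
Qed.

(** * Collapse of P to a convolution with the Dirichlet inverse g *)

Section NumericalPolynomials.
Variable g : nat -> {poly rat}.
Hypothesis g_inv : forall n, (0 < n)%N ->
  \sum_(d <- divisors n) 'X^(n %/ d - 1) * g d = (n == 1%N)%:R.

(** The row with entries [g d] over [d], multiplied by [zeta_mx n], is the unit row at the divisor
    1: the factors [d] cancel and [g_inv] remains. It is therefore the row of the inverse matrix
    indexed by 1. *)
Lemma mu1E n : (0 < n)%N -> mu 1 n = n%:R^-1 *: g n.
Proof.
move=> n0; have sz : (0 < size (divisors n))%N.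
  by rewrite -has_predT; apply/hasP; exists n => //; apply: divisors_id.
have szE : (size (divisors n)).-1.+1 = size (divisors n) by rewrite prednK.
pose D (i : 'I_(size (divisors n)).-1.+1) := nth 0%N (divisors n) i.
have ltD (i : 'I_(size (divisors n)).-1.+1) : (i < size (divisors n))%N.
  by rewrite -[X in (_ < X)%N]szE.
have Dn i : (D i %| n)%N.
  by rewrite dvdn_divisors // mem_nth.
have indexK d : (d %| n)%N -> D (inord (index d (divisors n))) = d.
  rewrite dvdn_divisors // => dn; rewrite /D inordK ?nth_index //.
  by rewrite szE index_mem.
have sumD (F : nat -> {poly rat}) : \sum_i F (D i) = \sum_(d <- divisors n) F d.
  rewrite (big_nth 0%N) -[in RHS]szE big_mkord.
  by apply: eq_bigr.
pose r := \row_i ((D i)%:R^-1 *: g (D i)).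
suff rE : r *m zeta_mx n = delta_mx 0 (inord (index 1%N (divisors n))).
  have := congr1 (fun u => u *m invmx (zeta_mx n)) rE.
  rewrite mulmxK ?zeta_mx_unit // -rowE => /rowP.
  by move=> /(_ (inord (index n (divisors n)))); rewrite !mxE indexK.
apply/rowP => j; rewrite !mxE eqxx /=.
have Dj0 : (0 < D j)%N by apply: dvdn_gt0 (Dn j).
transitivity ((D j)%:R^-1 *: \sum_(d <- divisors (D j)) 'X^(D j %/ d - 1) * g d).
  rewrite -(sum_divisors_sub _ xpredT n0 (Dn j)) /= scaler_sumr [RHS]big_mkcond -sumD.
  apply: eq_bigr => i _; rewrite !mxE /zeta -/(D i) -/(D j).
  case: ifP => _; last by rewrite mulr0.
  have Di0 : (D i)%:R != 0 :> rat by rewrite pnatr_eq0 -lt0n (dvdn_gt0 n0 (Dn i)).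
  by rewrite -scalerAl -scalerAr scalerA mulrA mulVf // mul1r mulrC.
rewrite g_inv //; have <- : (D j == 1%N) = (j == inord (index 1%N (divisors n))).
  apply/eqP/eqP => [Dj|->]; last by rewrite indexK ?dvd1n.
  apply/val_inj/eqP.
  rewrite -(nth_uniq 0%N (ltD _) (ltD _) (divisors_uniq n)).
  by rewrite -/(D j) -/(D (inord _)) indexK ?dvd1n // Dj.
by case: (D j =P 1%N) => [->|_]; rewrite ?scaler0 // invr1 scale1r.
Qed.

Lemma tauE i n : (0 < n)%N -> (i %| n)%N ->
  tau i n = n%:R^-1 *: \sum_(d <- divisors i) g d * 'X^(n %/ d - 1).
Proof.
move=> n0 ni; have i0 := dvdn_gt0 n0 ni.
rewrite /tau scaler_sumr; apply: eq_big_seq => d.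
rewrite -dvdn_divisors // => di; have d0 := dvdn_gt0 i0 di.
rewrite mu1E // /zeta (dvdn_trans di ni) -scalerAl -scalerAr scalerA mulrA mulVf.
  by rewrite mul1r.
by rewrite pnatr_eq0 -lt0n.
Qed.

Variables i j : nat.
Hypotheses (i0 : (0 < i)%N) (j0 : (0 < j)%N).
Let l := lcmn i j.
Let s := (l %/ i + l %/ j)%N.

Let l0 : (0 < l)%N. Proof. by rewrite lcmn_gt0 i0. Qed.
Let li0 : (0 < l %/ i)%N. Proof. by rewrite divn_gt0 // dvdn_leq // dvdn_lcml. Qed.
Let lj0 : (0 < l %/ j)%N. Proof. by rewrite divn_gt0 // dvdn_leq // dvdn_lcmr. Qed.

(** The scalar [n * j / gcdn i j] equals [l %/ i * n] and cancels the denominator from [tauE]. After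
    swapping the sums, [sum_S_sum] evaluates the sum over [d], and the two exponents add up to
    [s * (n %/ c) - 1]. *)
Lemma qPE n : (0 < n)%N -> n%:R *: qP (l * n) i j =
  \sum_(c <- divisors n) g c * 'X^(s * (n %/ c) - 1).
Proof.
move=> n0; rewrite /qP -/l mulKn //.
have -> : (l * n %/ i = l %/ i * n)%N by rewrite divn_mulAC // dvdn_lcml.
have an0 : (0 < l %/ i * n)%N by rewrite muln_gt0 li0.
have gcd0 : (0 < gcdn i j)%N by rewrite gcdn_gt0 i0.
have jl : (j = l %/ i * gcdn i j)%N.
  apply/eqP; rewrite -(eqn_pmul2l i0) mulnA [(i * (l %/ i))%N]mulnC divnK ?dvdn_lcml //.
  by rewrite muln_lcm_gcd.
have coef : n%:R * (j%:R / (gcdn i j)%:R) = (l %/ i * n)%:R :> rat.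
  rewrite [in X in X / _]jl natrM mulfK ?pnatr_eq0 -?lt0n //.
  by rewrite -natrM mulnC.
rewrite scalerA coef scaler_sumr.
rewrite (eq_big_seq (fun d => \sum_(c <- divisors (n %/ d))
    g c * 'X^(l %/ i * n %/ c - 1) * S_sum 'X^(l %/ j) d)); last first.
  move=> d; rewrite -dvdn_divisors // => dn; rewrite divnMl // tauE //; last first.
    by rewrite dvdn_mull // dvdn_div.
  rewrite -scalerAl scalerA mulfV ?scale1r ?mulr_suml //.
  by rewrite pnatr_eq0 -lt0n.
rewrite sum_divisors_swap //; apply: eq_big_seq => c.
rewrite -dvdn_divisors // => cn; have c0 := dvdn_gt0 n0 cn.
have nc0 : (0 < n %/ c)%N by rewrite divn_gt0 // dvdn_leq.
rewrite -mulr_sumr sum_S_sum // -mulrA -exprM -exprD -muln_divA //.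
congr (_ * 'X^_); rewrite /s mulnDl addnBAC // muln_gt0 li0 //.
Qed.

Lemma PE n : (0 < n)%N -> n%:R *: P (l * n) i j =
  \sum_(c <- divisors n) g c * 'X^(s * (n %/ c) - 2).
Proof.
(* With [s] at least 2 the exponents [s * (n %/ c) - 2] are not truncated, so multiplying by ['X]
   recovers [qPE]. *)
move=> n0; have s1 : (1 < s)%N by rewrite /s -addn1 leq_add.
apply: (mulIf (negbT (polyX_eq0 _))); rewrite -scalerAl /P divpK ?dvdX_qP // qPE //.
rewrite mulr_suml; apply: eq_big_seq => c.
rewrite -dvdn_divisors // => cn; have c0 := dvdn_gt0 n0 cn.
have nc0 : (0 < n %/ c)%N by rewrite divn_gt0 // dvdn_leq.
rewrite -mulrA -exprSr -subSn ?subSS //.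
by rewrite (leq_trans s1) // leq_pmulr.
Qed.

(** For a fixed quotient [d] of [m] by [c], the sum over [c] is the left side of [g_inv] at
    [n %/ d], so only [d = n] survives. *)
Lemma sum_P n : (0 < n)%N ->
  \sum_(m <- divisors n) 'X^(n %/ m - 1) * (m%:R *: P (l * m) i j) = 'X^(s * n - 2).
Proof.
move=> n0.
rewrite (eq_big_seq (fun m => \sum_(c <- divisors m)
    'X^(n %/ m - 1) * (g c * 'X^(s * (m %/ c) - 2)))); last first.
  move=> m; rewrite -dvdn_divisors // => /(dvdn_gt0 n0) m0.
  by rewrite PE // mulr_sumr.
rewrite -(sum_divisors_exchange (fun c m =>
  'X^(n %/ m - 1) * (g c * 'X^(s * (m %/ c) - 2)))) // sum_divisors_swap //.
rewrite (eq_big_seq (fun d => (n == d)%:R * 'X^(s * d - 2))); last first.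
  move=> d; rewrite -dvdn_divisors // => dn; have d0 := dvdn_gt0 n0 dn.
  have nd0 : (0 < n %/ d)%N by rewrite divn_gt0 // dvdn_leq.
  have -> : (n == d) = (n %/ d == 1)%N by rewrite eq_sym [RHS]eq_sym eqn_div // mul1n.
  rewrite -g_inv // mulr_suml; apply: eq_big_seq => c.
  rewrite -dvdn_divisors // => /(dvdn_gt0 nd0) c0.
  by rewrite mulKn // mulrA [(c * d)%N]mulnC divnMA.
rewrite (bigD1_seq n) ?divisors_uniq -?dvdn_divisors //= eqxx mul1r.
by rewrite big1 ?addr0 // => d; rewrite eq_sym => /negbTE ->; rewrite mul0r.
Qed.

(** The system has an integer solution [a], which by uniqueness over the rationals agrees with [m]
    times the value of [P]. Then [dvdz_necklace] makes that value an integer, hence equal to its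
    numerator [P_at]. *)
Lemma sum_P_at (q : int) n : (0 < n)%N ->
  \sum_(m <- divisors n) q ^+ (n %/ m - 1) * (m%:Z * P_at (l * m) i j q) =
  q ^+ (s * n - 2).
Proof.
have s1 : (1 < s)%N by rewrite /s -addn1 leq_add.
have [a aE] := sum_divisors_solve (f := fun m => q ^+ (m - 1)) erefl (fun m => q ^+ (s * m - 2)).
have PaE m : (0 < m)%N -> m%:R * (P (l * m) i j).[q%:~R] = (a m)%:~R :> rat.
  pose f m := q%:~R ^+ (m - 1) : rat.
  move: m; apply: (sum_divisors_inj (f := f)) => // m m0.
  have := congr1 (fun p => p.[q%:~R]) (sum_P m0).
  rewrite /= hornerXn -rmorphXn -aE // rmorph_sum horner_sum /=.
  under eq_bigr do rewrite hornerM hornerXn hornerZ.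
  by move=> ->; apply: eq_bigr => d _; rewrite rmorphM /= rmorphXn.
move=> n0; rewrite -aE //; apply: eq_big_seq => m.
rewrite -dvdn_divisors // => /(dvdn_gt0 n0) m0; congr (_ * _).
have /dvdzP[b ab] := dvdz_necklace s1 aE m0.
rewrite ab mulrC; congr (_ * _); rewrite /P_at.
suff -> : (P (l * m) i j).[q%:~R] = b%:~R by rewrite numq_int.
have mn0 : m%:R != 0 :> rat by rewrite pnatr_eq0 -lt0n.
by apply: (mulfI mn0); rewrite PaE // ab rmorphM mulrC.
Qed.

End NumericalPolynomials.

(** * The ghost map: bijectivity and multiplicativity *)

Lemma sum_nat_divisors (V : nmodType) n m (F : nat -> V) : (0 < n)%N -> (m %| n)%N ->
  \sum_(1 <= d < m.+1 | (d %| m)%N) F d = \sum_(d <- divisors n | (d %| m)%N) F d.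
Proof.
move=> n0 mn; have m0 := dvdn_gt0 n0 mn.
rewrite (sum_divisors_sub F xpredT) // -[LHS]big_filter; apply: perm_big.
apply: uniq_perm; rewrite ?filter_uniq ?iota_uniq ?divisors_uniq // => d.
rewrite mem_filter mem_index_iota -dvdn_divisors // ltnS.
by case: (boolP (d %| m)%N) => //= dm; rewrite (dvdn_gt0 m0 dm) dvdn_leq.
Qed.

Section GhostMap.
Variables (q : int) (R : comPzRingType).
Implicit Types x y : Ap q R.

Lemma coord_val (x : posnat -> R) n (n0 : (0 < n)%N) :
  Defs.coord x n = x (exist _ n n0).
Proof. by rewrite /Defs.coord insubT. Qed.

Lemma phi_bijective : bijective (@phi q R).
Proof.
pose f m := (q%:~R : R) ^+ (m - 1).
have phi_inj : injective (@phi q R).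
  move=> x y xy; apply/funext => -[n n0]; rewrite -!coord_val.
  move: n n0; apply: (sum_divisors_inj (f := f) erefl) => n n0.
  exact: (congr1 (fun u => u (exist _ n n0)) xy).
have phi_surj (z : Gh R) : exists x, phi x = z.
  have [u uE] := sum_divisors_solve (f := f) erefl (Defs.coord z).
  exists (fun k => u (val k)); apply/funext => -[n n0]; rewrite -(coord_val z) -uE //.
  apply: eq_big_seq => d; rewrite -dvdn_divisors // => /(dvdn_gt0 n0) d0.
  by rewrite coord_val.
have [psi psiE] := choice phi_surj.
by exists psi => // x; apply: phi_inj; rewrite psiE.
Qed.

(** Letting [i] and [j] range over the divisors of [n], independently of [m], allows the sum over
    [m] to be moved inside in [phi_Ap_mul]. The added indices fail the lcm condition. *)
Lemma coord_Ap_mul x y n m : (0 < n)%N -> (m %| n)%N ->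
  Defs.coord (Ap_mul x y) m =
  \sum_(i <- divisors n) \sum_(j <- divisors n | (lcmn i j %| m)%N)
    (m %/ lcmn i j)%:R * (P_at m i j q)%:~R * Defs.coord x i * Defs.coord y j.
Proof.
move=> n0 mn; have m0 := dvdn_gt0 n0 mn.
have nosum i (r : seq nat) (F : nat -> R) : ~~ (i %| m)%N ->
    \sum_(j <- r | (lcmn i j %| m)%N) F j = 0.
  by move=> im; rewrite big_pred0 // => j; rewrite dvdn_lcm (negbTE im).
rewrite coord_val /Ap_mul /= (bigID (fun i => i %| m)%N) /=.
rewrite [X in _ + X]big1 => [|i]; last exact: nosum.
rewrite addr0 (sum_nat_divisors _ n0 mn) [RHS](bigID (fun i => i %| m)%N) /=.
rewrite [X in _ = _ + X]big1 => [|i]; last exact: nosum.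
rewrite addr0; apply: eq_bigr => i im.
have lcmE j : (lcmn i j %| m)%N = (j %| m)%N by rewrite dvdn_lcm im.
by rewrite (eq_bigl _ _ lcmE) [RHS](eq_bigl _ _ lcmE) (sum_nat_divisors _ n0 mn).
Qed.

Lemma phi_Ap_mul x y : phi (Ap_mul x y) = phi x * phi y.
Proof.
apply/funext => -[n n0]; rewrite /phi /=.
rewrite (eq_big_seq (fun m => \sum_(i <- divisors n)
    \sum_(j <- divisors n | (lcmn i j %| m)%N) q%:~R ^+ (n %/ m - 1) *
      ((m %/ lcmn i j)%:R * (P_at m i j q)%:~R * Defs.coord x i * Defs.coord y j))); last first.
  move=> m; rewrite -dvdn_divisors // => mn.
  rewrite (coord_Ap_mul _ _ n0 mn) mulr_sumr.
  by apply: eq_bigr => i _; rewrite mulr_sumr.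
rewrite -[RHS]/(phi x (exist _ n n0) * phi y (exist _ n n0)) /phi /= big_distrlr /=.
rewrite exchange_big; apply: eq_big_seq => i.
rewrite -dvdn_divisors // => idn; have i0 := dvdn_gt0 n0 idn.
rewrite (exchange_big_dep xpredT) //=; apply: eq_big_seq => j.
rewrite -dvdn_divisors // => jdn; have j0 := dvdn_gt0 n0 jdn.
have l0 : (0 < lcmn i j)%N by rewrite lcmn_gt0 i0.
have ldn : (lcmn i j %| n)%N by rewrite dvdn_lcm idn.
have nl0 : (0 < n %/ lcmn i j)%N by rewrite divn_gt0 // dvdn_leq.
rewrite sum_divisors_multiples //.
(* This is the term of [x_i y_j] in the product of the ghost components. Its exponent is the one in
   [sum_P_at] at [n %/ lcmn i j]. *)
transitivity ((q%:~R ^+ (n %/ i - 1 + (n %/ j - 1)) : R) * (Defs.coord x i * Defs.coord y j)).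
  have -> : (n %/ i - 1 + (n %/ j - 1) =
      (lcmn i j %/ i + lcmn i j %/ j) * (n %/ lcmn i j) - 2)%N.
    have ni0 : (0 < n %/ i)%N by rewrite divn_gt0 // dvdn_leq.
    have nj0 : (0 < n %/ j)%N by rewrite divn_gt0 // dvdn_leq.
    have quotE k : (k %| lcmn i j)%N -> (lcmn i j %/ k * (n %/ lcmn i j) = n %/ k)%N.
      by move=> kl; rewrite mulnC muln_divA // divnK.
    by rewrite mulnDl !quotE ?dvdn_lcml ?dvdn_lcmr //; lia.
  (* Solving for the indicator of 1 yields the Dirichlet inverse [g]. *)
  have [g gE] := sum_divisors_solve (f := fun m => 'X^(m - 1) : {poly rat}) erefl
    (fun m => (m == 1)%N%:R).
  rewrite -rmorphXn /= -(sum_P_at gE i0 j0) // rmorph_sum mulr_suml.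
  apply: eq_bigr => m _; rewrite !rmorphM /= rmorphXn mulKn // divnMA -pmulrn.
  by rewrite !mulrA.
by rewrite exprD mulrACA.
Qed.

End GhostMap.

Theorem proposition6p5 (q : int) (R : comPzRingType) :
  (GRing.zmod_morphism (@phi q R) /\ bijective (@phi q R)) /\
  (forall x y : Ap q R, phi (Ap_mul x y) = phi x * phi y).
Proof.
split; last exact: phi_Ap_mul.
split; last exact: phi_bijective.
move=> x y; apply/funext => k; rewrite /phi -[RHS]sumrB; apply: eq_bigr => d _.
rewrite -mulrBr; congr (_ * _); rewrite /Defs.coord.
(* At index 0 every coordinate is the default 0, and the identity reads [0 = 0 - 0]. *)
by case: insub => [?|] //; rewrite subr0.
Qed.
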